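(* Let $1\le\lambda_1<\lambda_2<\cdots<\lambda_d<\cdots<\sqrt2$ be a fixed infinite sequence and for $d\in\mathbb N$ let $$E_d:=\Big\{x\in\mathbb R^d:\ \sum_{j=1}^d\lambda_j^2x_j^2\le1\Big\},\qquad \mathcal C_p(E_d):=\sup_{\|f\|_{\ell^p(\mathbb Z^d)}\le1}\Big\|\sup_{t>0}|\mathcal M_t^{E_d}f|\Big\|_{\ell^p(\mathbb Z^d)} .$$ Then for every $p\in(1,\infty)$ there exists a constant $C_p>0$ such that for all $d\in\mathbb N$ $$\mathcal C_p(E_d)\ge C_p\,(\log d)^{1/p}.$$
   Context: For a set $G\subset\mathbb R^d$ (bounded, closed, symmetric, convex, with non-empty interior), $t>0$, $f:\mathbb Z^d\to\mathbb C$ and $x\in\mathbb Z^d$, let $G_t=\{y\in\mathbb R^d:t^{-1}y\in G\}$ and $$\mathcal M_t^Gf(x)=\frac{1}{|G_t\cap\mathbb Z^d|}\sum_{y\in G_t\cap\mathbb Z^d}f(x-y),$$ where $|G_t\cap\mathbb Z^d|$ is the number of elements of $G_t\cap\mathbb Z^d$. *)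

(* Defs.v *)
From HB Require Import structures.
From mathcomp Require Import all_boot all_order all_algebra finmap.
From mathcomp.real_closed Require Import complex.
From mathcomp Require Import all_classical all_reals all_analysis.
Set Implicit Arguments.
Unset Strict Implicit.
Unset Printing Implicit Defensive.
Import Order.TTheory GRing.Theory Num.Theory.
Local Open Scope classical_set_scope.
Local Open Scope ring_scope.

Definition dilate (R : realType) (d : nat) (t : R) (G : set 'rV[R]_d) :
    set 'rV[R]_d :=
  [set y | G (t^-1 *: y)].

Definition lattice_points (R : realType) (d : nat) (G : set 'rV[R]_d) :
    set 'rV[int]_d :=
  [set y | G (map_mx intr y)].

(* [fset_set A] enumerates [A] when [A] is finite and is empty otherwise; the
   sets of lattice points below are finite because [G] is meant to be bounded. *)
Definition discrete_avg (R : realType) (d : nat) (G : set 'rV[R]_d) (t : R)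
    (f : 'rV[int]_d -> R[i]) (x : 'rV[int]_d) : R[i] :=
  let A := fset_set (lattice_points (dilate t G)) in
  (#|` A|%:R)^-1 * \sum_(y <- A) f (x - y).

(* The real-valued modulus; the order-theoretic [`|z|] of [z : R[i]] lies in
   [R[i]]. *)
Definition modulus (R : realType) (z : R[i]) : R := ComplexField.Normc.normc z.

(* The value +oo is allowed, both for the argument and for the norm. *)
Definition lp_norm (R : realType) (d : nat) (p : R)
    (g : 'rV[int]_d -> \bar R) : \bar R :=
  poweR (\esum_(x in setT) poweR `|g x|%E p) p^-1.

Definition maximal_fun (R : realType) (d : nat) (G : set 'rV[R]_d)
    (f : 'rV[int]_d -> R[i]) (x : 'rV[int]_d) : \bar R :=
  ereal_sup [set (modulus (discrete_avg G t f x))%:E | t in [set t : R | 0 < t]].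

Definition maximal_const (R : realType) (d : nat) (p : R)
    (G : set 'rV[R]_d) : \bar R :=
  ereal_sup [set lp_norm p (maximal_fun G f) |
    f in [set f : 'rV[int]_d -> R[i] |
           (lp_norm p (fun x => (modulus (f x))%:E) <= 1)%E]].

(* The sequence is indexed from 0: [lam j] is the coefficient of the
   coordinate with index [j : 'I_d], usually written lambda_(j+1). *)
Definition ellipsoid (R : realType) (lam : nat -> R) (d : nat) :
    set 'rV[R]_d :=
  [set x | \sum_(j < d) lam j ^+ 2 * x ord0 j ^+ 2 <= 1].

Arguments ellipsoid {R} lam d.

(* Main.v *)
Require Import Defs.
From HB Require Import structures.
From mathcomp Require Import all_boot all_order all_algebra finmap.
From mathcomp.real_closed Require Import complex.
From mathcomp Require Import all_classical all_reals all_analysis.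
From mathcomp Require Import ring lra zify.
Set Implicit Arguments.
Unset Strict Implicit.
Unset Printing Implicit Defensive.
Import Order.TTheory GRing.Theory Num.Theory.
Local Open Scope ring_scope.

(** Only one feature of the ellipsoids matters: for t = lam m the set
    E_t /\ Z^d consists of 0 and of the vectors +-e_j with j <= m.  Two nonzero
    coordinates, or one of absolute value at least 2, already make the quadratic
    form at least 2 > t^2, and as lam is strictly increasing the direction e_j
    enters exactly at time lam j ([lattice_points_ellipsoid]).  So the averages
    run through the stars around x in the first m + 1 directions, for all m < d.

    Group the coordinates into dyadic blocks, the i-th one consisting of the 2^i
    indices j with 2^i <= j + 1 < 2^(i+1).  Let F be the set of vertices of the
    cube {0,1}^d with an even number of ones in every block, and let A_i be the
    set of vertices with an odd number of ones in the i-th block only.  At a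
    point x of A_i, flipping any of the 2^i coordinates of the i-th block leads
    into F, and each such move is a step +-e_j within a star of at most 2^(i+2)
    points.  The maximal function of 1_F is therefore at least 1/4 on A_i
    ([maximal_fun_vertex]).  The A_i are pairwise disjoint and each has as many
    points as F, because one fixed flip in the i-th block is a bijection between
    the two ([card_flipped]).  With L full blocks this gives
      || sup_t |M_t 1_F| ||_p^p >= 4^-p L |F| = 4^-p L ||1_F||_p^p,
    and L is comparable to log d ([ln_le_trunc_log]).

    Staying inside the cube avoids boundary terms: of x + e_j and x - e_j exactly
    one is a vertex, namely x with its j-th coordinate flipped. *)

(** * Norms of functions on the lattice *)

Lemma le_lp_norm (R : realType) (d : nat) (p : R) (g h : 'rV[int]_d -> \bar R) :
  0 < p -> (forall x, `|g x| <= `|h x|)%E -> (lp_norm p g <= lp_norm p h)%E.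
Proof.
move=> p0 gh.
have nneg (u : \bar R) : (0 <= u)%E -> u \in `[0%E, +oo%E].
  by rewrite in_itv /= leey andbT.
have nneg_sum (g' : 'rV[int]_d -> \bar R) :
    (0 <= \esum_(x in setT) poweR `|g' x| p)%E.
  by apply: esum_ge0 => x _; exact: poweR_ge0.
apply: gt0_ler_poweR; rewrite ?invr_ge0 ?(ltW p0) ?nneg ?nneg_sum//.
apply: le_esum => x _.
by apply: gt0_ler_poweR; rewrite ?gh ?(ltW p0) ?nneg.
Qed.

Lemma lp_norm_indic (R : realType) (d : nat) (p c : R) (W : {fset 'rV[int]_d}) :
  0 < p -> 0 <= c ->
  lp_norm p (fun x => (c * (x \in W)%:R)%:E) = (c * #|` W|%:R `^ p^-1)%:E.
Proof.
move=> p0 c0; rewrite /lp_norm.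
rewrite (@eq_esum _ _ _ _
  (fun x => if x \in [set` W]%classic then (c `^ p)%:E else 0%E)); last first.
  move=> x _; rewrite mem_setE; case: (x \in W).
    by rewrite mulr1 abse_EFin ger0_norm.
  by rewrite mulr0 abse0 poweR0r // gt_eqF.
rewrite -esum_mkcond esum_fset //; last first.
  by move=> x _; rewrite lee_fin powR_ge0.
rewrite fsbig_finite // set_fsetK sumEFin big_const_seq count_predT iter_addr_0.
rewrite poweR_EFin -[_ *+ _]mulr_natr powRM ?powR_ge0 //.
by rewrite -powRrM divff ?gt_eqF// powRr1.
Qed.

(** * Averages over stars *)

Lemma modulus_avg_indic (R : realType) (d : nat) (G : set 'rV[R]_d) (t c : R)
    (W : {fset 'rV[int]_d}) (x : 'rV[int]_d) :
  0 <= c ->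
  let A := fset_set (lattice_points (dilate t G)) in
  modulus (discrete_avg G t (fun z => (c * (z \in W)%:R)%:C%C) x) =
    c * (count (fun y => x - y \in W) A)%:R / #|` A|%:R.
Proof.
move=> c0 A; rewrite /discrete_avg -/A -rmorph_sum -mulr_sumr.
rewrite -(rmorph_nat (real_complex R)) -fmorphV -rmorphM /= /modulus /=.
rewrite expr0n /= addr0 sqrtr_sqr.
have -> : \sum_(y <- A) (x - y \in W)%:R = (count (fun y => x - y \in W) A)%:R :> R.
  rewrite -sum1_count natr_sum [RHS]big_mkcond /=.
  by apply: eq_bigr => y _; case: (x - y \in W).
by rewrite ger0_norm 1?mulrC // !mulr_ge0 ?invr_ge0.
Qed.

(** The star of the origin in the directions [j <= m]. *)
Definition cross (d m : nat) : seq 'rV[int]_d :=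
  0 :: [seq s *: delta_mx ord0 j |
          s <- [:: 1; -1], j <- enum [pred j : 'I_d | (j <= m)%N]].

Lemma size_cross (d m : nat) : (size (cross d m) <= m.*2 + 3)%N.
Proof.
rewrite /cross /= cats0 size_cat !size_map -cardE.
set n := #|_|.
have : (n <= m.+1)%N.
  rewrite -[leqRHS](size_iota 0) /n cardE -(size_map val).
  apply: uniq_leq_size.
    by rewrite map_inj_uniq ?enum_uniq //; exact: val_inj.
  by move=> k /mapP[j]; rewrite mem_enum inE => jm ->; rewrite mem_iota.
lia.
Qed.

Lemma crossP (d m : nat) (y : 'rV[int]_d) :
  reflect (y = 0 \/ exists (s : int) (j : 'I_d),
             [/\ s = 1 \/ s = -1, (j <= m)%N & y = s *: delta_mx ord0 j])
    (y \in cross d m).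
Proof.
rewrite in_cons; apply: (iffP orP) => [[/eqP -> | ] | [-> | [s [j [ss jm ->]]]]].
- by left.
- move=> /allpairsP[[s j] /= [ss]]; rewrite mem_enum => jm ->.
  right; exists s, j; split=> //.
  by move: ss; rewrite !inE => /orP[] /eqP ->; [left | right].
- by left; rewrite eqxx.
- right; apply: allpairs_f; last by rewrite mem_enum.
  by case: ss => ->; rewrite !inE eqxx ?orbT.
Qed.

(** Since every [lam j ^+ 2] is at least 1 and [lam m ^+ 2 < 2], a lattice point
    of the dilated ellipsoid has at most one nonzero coordinate, of absolute
    value 1; monotonicity of [lam] decides in which directions it may lie. *)
Lemma lattice_points_ellipsoid (R : realType) (lam : nat -> R) (d m : nat) :
  1 <= lam 0%N -> (forall j, lam j < lam j.+1) ->
  (forall j, lam j < Num.sqrt 2) ->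
  lattice_points (dilate (lam m) (ellipsoid lam d)) = [set` cross d m]%classic.
Proof.
move=> lam0 lamS lam2.
have lam_mono : {mono lam : i j / (i <= j)%N >-> i <= j}.
  by apply: le_mono; apply: homo_ltn => //; exact: lt_trans.
have lam_ge1 j : 1 <= lam j by rewrite (le_trans lam0) // lam_mono.
have lam_ge0 j : 0 <= lam j by rewrite (le_trans _ (lam_ge1 j)).
have lam_sq j : 1 <= lam j ^+ 2 by rewrite expr_ge1.
have t2_lt2 : lam m ^+ 2 < 2.
  by rewrite -[ltRHS](@sqr_sqrtr R 2) // ltr_pXn2r ?nnegrE ?sqrtr_ge0.
have int_sq (z : int) : z != 0 -> 1 <= (z%:~R : R) ^+ 2.
  by move=> z0; rewrite -rmorphXn /= ler1z; nia.
have memE y : (lattice_points (dilate (lam m) (ellipsoid lam d)) y) =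
    (\sum_(j < d) lam j ^+ 2 * (y ord0 j)%:~R ^+ 2 <= lam m ^+ 2) :> Prop.
  rewrite /lattice_points /dilate /ellipsoid /=; congr (is_true _).
  under eq_bigr do rewrite !mxE exprMn mulrCA.
  by rewrite -mulr_sumr exprVn ler_pdivrMl ?mulr1 // (lt_le_trans ltr01).
apply/seteqP; split => y; rewrite memE /=; last first.
  move=> /crossP[-> | [s [j [ss jm ->]]]].
    by rewrite big1 ?sqr_ge0 // => j _; rewrite mxE expr0n mulr0.
  rewrite (bigD1 j) //= big1 ?addr0.
    rewrite !mxE !eqxx /= mulr1.
    have -> : (s%:~R : R) ^+ 2 = 1.
      by rewrite -rmorphXn; case: ss => ->.
    by rewrite mulr1 ler_pXn2r ?nnegrE // lam_mono.
  by move=> k /negbTE kj; rewrite !mxE kj mulr0 expr0n mulr0.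
have term_ge0 (j : 'I_d) : 0 <= lam j ^+ 2 * (y ord0 j)%:~R ^+ 2.
  by rewrite mulr_ge0 ?sqr_ge0.
have term_ge1 (j : 'I_d) :
    y ord0 j != 0 -> lam j ^+ 2 <= lam j ^+ 2 * (y ord0 j)%:~R ^+ 2.
  by move=> yj; rewrite ler_peMr ?sqr_ge0 // int_sq.
move=> ball; apply/crossP.
have [->|/rV0Pn[j yj]] := eqVneq y 0; [by left | right].
have y_other k : k != j -> y ord0 k = 0.
  move=> kj; apply/eqP; apply: contraTT ball => yk; rewrite -ltNge.
  apply: lt_le_trans t2_lt2 _.
  rewrite (bigD1 j) //= (bigD1 k) //= addrA -[2]addr0.
  apply: lerD; last by apply: sumr_ge0.
  apply: lerD; first by apply: le_trans (term_ge1 j yj).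
  by apply: le_trans (term_ge1 k yk).
move: ball; rewrite (bigD1 j) //= big1 ?addr0; last first.
  by move=> k kj; rewrite y_other // expr0n mulr0.
move=> ball.
have yj1 : (y ord0 j) ^+ 2 < 2.
  have : ((y ord0 j)%:~R : R) ^+ 2 < 2.
    apply: le_lt_trans t2_lt2; apply: le_trans ball.
    by rewrite ler_peMl ?sqr_ge0.
  by rewrite -rmorphXn -[2]/(2%:~R) ltr_int.
exists (y ord0 j), j; split.
- by move: yj yj1; set z := y _ _; nia.
- rewrite -lam_mono -(@ler_pXn2r _ 2) ?nnegrE //.
  exact: le_trans (term_ge1 j yj) ball.
- apply/rowP => k; rewrite !mxE eqxx /=.
  by have [->|/y_other ->] := eqVneq k j; rewrite ?mulr1 ?mulr0.
Qed.

(** * Parities in dyadic blocks of the cube *)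

(** Coordinates are numbered from 0, hence the shift. *)
Definition blk (j : nat) : nat := trunc_log 2 j.+1.

Section Cube.
Variable d : nat.
Implicit Types (j k : 'I_d) (X Y : {set 'I_d}).

Definition flip j X : {set 'I_d} := [set k | (k \in X) (+) (k == j)].

(** Written as a sum modulo 2 so that it is additive for the symmetric
    difference that defines [flip]. *)
Definition parity (b : nat) X : bool :=
  \big[addb/false]_(k : 'I_d | blk k == b) (k \in X).

(** Quantifying over coordinates rather than over block numbers ranges over the
    nonempty blocks, whatever [d] is. *)
Definition balanced : {set {set 'I_d}} :=
  [set X | [forall j : 'I_d, ~~ parity (blk j) X]].

Definition vertex X : 'rV[int]_d := \row_j (j \in X)%:R.

Lemma flipK j : involutive (flip j).
Proof. by move=> X; apply/setP => k; rewrite !inE -addbA addbb addbF. Qed.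

Lemma parity_flip j b X : parity b (flip j X) = parity b X (+) (blk j == b).
Proof.
rewrite /parity; under eq_bigr do rewrite inE.
rewrite big_split /=; congr (_ (+) _).
have [bj|bj] := boolP (blk j == b).
  rewrite (bigD1 j) //= eqxx big1 // => k /andP[_ /negbTE]; exact.
by rewrite big1 // => k bk; apply: contraNF bj => /eqP <-.
Qed.

(** The two flips change the parity of the same block, so they cancel. *)
Lemma balanced_flip2 j k X :
  blk j = blk k -> X \in balanced -> flip j (flip k X) \in balanced.
Proof.
move=> jk; rewrite !inE => /forallP bX; apply/forallP => i.
by rewrite !parity_flip jk -addbA addbb addbF.
Qed.

(** The block of the flipped coordinate can be read off from the result: it is
    the only one of odd parity. *)
Lemma balanced_flip_inj j k X Y :
  X \in balanced -> Y \in balanced -> flip j X = flip k Y -> blk j = blk k.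
Proof.
rewrite !inE => /forallP/(_ j)/negbTE bX /forallP/(_ j)/negbTE bY.
move=> /(congr1 (parity (blk j))); rewrite !parity_flip bX bY eqxx /=.
by move=> /esym/eqP.
Qed.

Lemma set0_balanced : finset.set0 \in balanced.
Proof. by rewrite inE; apply/forallP => j; rewrite /parity big1 // => k; rewrite inE. Qed.

Lemma vertex_inj : injective vertex.
Proof.
move=> X Y /rowP XY; apply/setP => k; have := XY k; rewrite !mxE.
by case: (k \in X); case: (k \in Y).
Qed.

(** Flipping a coordinate is a unit step along that axis, outwards or inwards
    according to whether the coordinate was 0 or 1. *)
Lemma vertex_sub_flip j X :
  vertex X - vertex (flip j X) = (-1) ^+ (j \notin X) *: delta_mx ord0 j.
Proof.
apply/rowP => k; rewrite !mxE inE eqxx /=.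
have [->|_] := eqVneq k j; case: (_ \in X); rewrite ?mulr1 ?mulr0 //=.
Qed.

End Cube.

Lemma card_blk (d i : nat) :
  (2 ^ i.+1 <= d.+1)%N -> (2 ^ i <= #|[set j : 'I_d | blk j == i]|)%N.
Proof.
rewrite expnS => id; have i0 : (0 < 2 ^ i)%N by rewrite expn_gt0.
rewrite -[leqLHS](size_iota (2 ^ i).-1) cardE -(size_map val).
apply: uniq_leq_size; first exact: iota_uniq.
move=> k; rewrite mem_iota => kb.
have kd : (k < d)%N by lia.
apply/mapP; exists (Ordinal kd) => //; rewrite mem_enum inE /=.
apply/eqP/trunc_log_eq => //; rewrite expnS; lia.
Qed.

(** * The maximal function on the cube *)

Definition vertices (d : nat) (F : {set {set 'I_d}}) : {fset 'rV[int]_d} :=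
  [fset vertex X | X in F]%fset.

Lemma card_vertices (d : nat) (F : {set {set 'I_d}}) : #|` vertices F| = #|F|.
Proof.
rewrite card_imfset /=; last exact: vertex_inj.
by rewrite cardE.
Qed.

(** Averaging at time [lam m] sees every neighbour of [X] that a flip in [B]
    leads to, among at most [2 (m + 1) + 1] points in total. *)
Lemma maximal_fun_vertex (R : realType) (lam : nat -> R) (d m : nat) (c : R)
    (F : {set {set 'I_d}}) (X B : {set 'I_d}) :
  1 <= lam 0%N -> (forall j, lam j < lam j.+1) ->
  (forall j, lam j < Num.sqrt 2) -> 0 <= c ->
  (forall j, j \in B -> (j <= m)%N /\ flip j X \in F) ->
  ((c * #|B|%:R / (m.*2 + 3)%:R)%:E <=
     maximal_fun (ellipsoid lam d)
       (fun z => (c * (z \in vertices F)%:R)%:C%C) (vertex X))%E.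
Proof.
move=> lam0 lamS lam2 c0 BF.
have t_gt0 : 0 < lam m.
  elim: m {BF} => [|m IH]; first exact: lt_le_trans lam0.
  exact: lt_trans (lamS m).
apply: (@le_trans _ _ (modulus (discrete_avg (ellipsoid lam d) (lam m)
    (fun z => (c * (z \in vertices F)%:R)%:C%C) (vertex X)))%:E); last first.
  by apply: ereal_sup_ubound; exists (lam m).
rewrite modulus_avg_indic // lattice_points_ellipsoid // lee_fin.
set A := fset_set _.
have finA : finite_set [set` cross d m]%classic by exact: finite_seq.
have AE y : (y \in A) = (y \in cross d m) by rewrite in_fset_set // mem_setE.
have A_gt0 : (0 < #|` A|)%N.
  by rewrite cardfs_gt0; apply/fset0Pn; exists 0; rewrite AE inE eqxx.
have A_le : (#|` A| <= m.*2 + 3)%N.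
  apply: leq_trans (size_cross d m); apply: uniq_leq_size => [|y].
    exact: fset_uniq.
  by rewrite AE.
have B_le : (#|B| <= count (fun y => (vertex X - y)%R \in vertices F) A)%N.
  rewrite -size_filter cardE -(size_map (fun j => vertex X - vertex (flip j X))).
  apply: uniq_leq_size.
    rewrite map_inj_in_uniq ?enum_uniq // => j k _ _ /addrI/oppr_inj/vertex_inj.
    by move/setP/(_ j); rewrite !inE eqxx => /addbI/esym/eqP.
  move=> z /mapP[j]; rewrite mem_enum => /BF[jm Fj] ->.
  rewrite mem_filter subKr in_imfset //= AE vertex_sub_flip; apply/crossP; right.
  exists ((-1) ^+ (j \notin X)), j; split=> //.
  by case: (_ \notin _); [right | left].
rewrite -!mulrA ler_wpM2l //; apply: ler_pM => //.
- by rewrite ler_nat.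
- by rewrite lef_pV2 ?posrE ?ltr0n ?ler_nat //; lia.
Qed.

(** [trunc_log 2 d.+1] is the number of dyadic blocks that fit in [d]
    coordinates; it is positive, so it absorbs the rounding. *)
Lemma ln_le_trunc_log (R : realType) (d : nat) :
  (0 < d)%N -> ln (d%:R : R) <= 2 * (trunc_log 2 d.+1)%:R.
Proof.
move=> d0; set L := trunc_log 2 d.+1.
have L0 : (0 < L)%N by rewrite trunc_log_gt0.
have dL : (d%:R : R) <= 2 ^+ L.+1.
  by rewrite -natrX ler_nat ltnW // ltnW // trunc_log_ltn.
have d_gt0 : 0 < (d%:R : R) by rewrite ltr0n.
apply: le_trans (_ : ln (2 ^+ L.+1 : R) <= _).
  by rewrite ler_ln ?posrE // exprn_gt0.
rewrite lnXn //.
have ln2 : ln (2 : R) <= 1.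
  by have := @le_ln1Dx R 1; rewrite -[1 + 1]/2; apply; lra.
have L1 : (1 : R) <= L%:R by rewrite ler1n.
rewrite -[_ *+ _]mulr_natr -natr1; nra.
Qed.

(** The union of the sets with exactly one odd block, each obtained from the
    balanced sets by flipping a chosen coordinate [head i] of that block. *)
Definition flipped (d L : nat) (head : 'I_L -> 'I_d) : {set {set 'I_d}} :=
  [set flip (head u.1) u.2 | u in finset.setX [set: 'I_L] (balanced d)].

(** The odd block of a member determines [i], and undoing the flip gives back the
    balanced set. *)
Lemma card_flipped (d L : nat) (head : 'I_L -> 'I_d) :
  (forall i, blk (head i) = i) -> #|flipped head| = (L * #|balanced d|)%N.
Proof.
move=> head_blk; rewrite card_in_imset ?cardsX ?finset.cardsT ?card_ord // => -[i X] [k Y].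
rewrite !finset.in_setX /= => /andP[_ bX] /andP[_ bY] e.
have ik : i = k.
  by apply: val_inj; rewrite /= -!head_blk (balanced_flip_inj bX bY e).
by move: e; rewrite ik => /(can_inj (flipK _)) ->.
Qed.

(** * The lower bound *)

Theorem theorem2 (R : realType) (lam : nat -> R)
    (lam_ge1 : 1 <= lam 0%N)
    (lam_incr : forall j : nat, lam j < lam j.+1)
    (lam_lt : forall j : nat, lam j < Num.sqrt 2) :
  forall p : R, 1 < p ->
    exists2 C : R, 0 < C &
      forall d : nat, (0 < d)%N ->
        ((C * powR (ln d%:R) p^-1)%:E <= maximal_const p (ellipsoid lam d))%E.
Proof.
move=> p p1; have p0 : 0 < p by rewrite (lt_trans ltr01).
have pV0 : 0 < p^-1 by rewrite invr_gt0.
(* 4 from the averages, 2 from comparing ln d with the number of blocks. *)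
exists (4 * 2 `^ p^-1)^-1; first by rewrite invr_gt0 mulr_gt0 // powR_gt0.
move=> d d0; set L := trunc_log 2 d.+1.
have pow_le i : (i < L)%N -> (2 ^ i.+1 <= d.+1)%N.
  move=> iL; apply: leq_trans (trunc_logP (isT : (1 < 2)%N) (ltn0Sn d)).
  by rewrite leq_exp2l.
have head_lt (i : 'I_L) : ((2 ^ i).-1 < d)%N.
  have i0 : (0 < 2 ^ i)%N by rewrite expn_gt0.
  by have := pow_le i (ltn_ord i); rewrite expnS; lia.
pose head i := Ordinal (head_lt i).
have head_blk i : blk (head i) = i.
  by rewrite /blk /= prednK ?expn_gt0 // trunc_expnK.
pose n := #|balanced d|.
have n_gt0 : 0 < (n%:R : R) `^ p^-1.
  rewrite powR_gt0 // ltr0n; apply/card_gt0P.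
  by exists finset.set0; exact: set0_balanced.
(* The height that makes f a unit vector. *)
pose c := ((n%:R : R) `^ p^-1)^-1.
have c0 : 0 <= c by rewrite invr_ge0 ltW.
pose f (z : 'rV[int]_d) : R[i] := (c * (z \in vertices (balanced d))%:R)%:C%C.
have f_norm : (lp_norm p (fun x => (modulus (f x))%:E) <= 1)%E.
  have -> : (fun x => (modulus (f x))%:E) =
            (fun x => (c * (x \in vertices (balanced d))%:R)%:E).
    apply/funext => x; rewrite /modulus /= expr0n addr0 sqrtr_sqr ger0_norm //.
    exact: mulr_ge0.
  by rewrite lp_norm_indic // card_vertices mulVf // gt_eqF.
apply: le_trans (_ : (lp_norm p (maximal_fun (ellipsoid lam d) f) <= _)%E); last first.
  by apply: ereal_sup_ubound; exists f.
apply: le_trans (_ : (lp_norm p (fun x =>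
    (c / 4 * (x \in vertices (flipped head))%:R)%:E) <= _)%E); last first.
  apply: le_lp_norm => // x.
  have [xW|_] := boolP (x \in _); last by rewrite mulr0 abse0.
  rewrite mulr1 abse_EFin ger0_norm ?divr_ge0 //.
  apply: le_trans (lee_abs _).
  have /imfsetP[Z /imsetP[[i X]]] := xW.
  rewrite finset.in_setX /= => /andP[_ bX] -> ->.
  (* The last coordinate of the i-th block. *)
  pose m := (2 ^ i.+1 - 2)%N; pose B := [set j : 'I_d | blk j == i].
  apply: le_trans (maximal_fun_vertex (m := m) (B := B) lam_ge1 lam_incr lam_lt c0 _).
    rewrite lee_fin -mulrA ler_wpM2l //.
    have := card_blk (pow_le i (ltn_ord i)); rewrite -/B.
    rewrite /m expnS ler_pdivlMr ?ltr0n; last by lia.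
    rewrite mulrC ler_pdivrMr // -natrM ler_nat.
    have : (0 < 2 ^ i)%N by rewrite expn_gt0.
    set K := (2 ^ i)%N; set b := #|B|. lia.
  move=> j; rewrite inE => /eqP ji; split.
    have := trunc_log_ltn j.+1 (isT : (1 < 2)%N); rewrite -/(blk j) ji /m; lia.
  by apply: balanced_flip2 => //; rewrite head_blk.
rewrite lp_norm_indic ?divr_ge0 // card_vertices card_flipped // -/n lee_fin.
rewrite natrM powRM ?ler0n //.
have -> : c / 4 * (L%:R `^ p^-1 * n%:R `^ p^-1) = 4^-1 * L%:R `^ p^-1.
  by rewrite /c; field; rewrite gt_eqF.
rewrite invfM -mulrA ler_wpM2l ?invr_ge0 // ler_pdivrMl ?powR_gt0 //.
rewrite -powRM ?ler0n // ge0_ler_powR ?(ltW pV0) ?nnegrE //.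
  by rewrite ln_ge0 // ler1n.
exact: ln_le_trunc_log.
Qed.
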